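(* Let $\Gamma$ be a group acting on a Polish space $X$ by Borel automorphisms (i.e. for every $\gamma\in\Gamma$ the map $x\mapsto \gamma\cdot x$ is Borel), and suppose this action has a paradoxical decomposition. Then the action has a paradoxical decomposition in which each piece has the Baire property.
   Context: A paradoxical decomposition of an action of a group $\Gamma$ on a set $X$ is a partition of $X$ into finitely many sets $\{A_1,\ldots,A_n,B_1,\ldots,B_m\}$ together with group elements $\alpha_1,\ldots,\alpha_n,\beta_1,\ldots,\beta_m\in\Gamma$ such that the sets $\alpha_iA_i$ are pairwise disjoint, the sets $\beta_iB_i$ are pairwise disjoint, and $X=\alpha_1A_1\cup\cdots\cup\alpha_nA_n=\beta_1B_1\cup\cdots\cup\beta_mB_m$. The pieces are the sets $A_i, B_j$. *)

(* Defs.v *)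
From mathcomp Require Import all_boot all_order all_algebra.
From mathcomp Require Import all_classical all_reals all_analysis.
Set Implicit Arguments.
Unset Strict Implicit.
Unset Printing Implicit Defensive.
Import Order.TTheory GRing.Theory Num.Theory.
Local Open Scope classical_set_scope.
Local Open Scope ring_scope.

Definition is_metric (R : realType) (X : Type) (d : X -> X -> R) : Prop :=
  [/\ forall x y, d x y = 0 <-> x = y,
      forall x y, d x y = d y x &
      forall x y z, d x z <= d x y + d y z].

(* [d] induces the given topology of [X] *)
Definition compatible_metric (R : realType) (X : topologicalType)
    (d : X -> X -> R) : Prop :=
  is_metric d /\
  forall (x : X) (U : set X),
    nbhs x U <-> exists2 e : R, 0 < e & [set y | d x y < e] `<=` U.

Definition complete_metric (R : realType) (X : topologicalType)
    (d : X -> X -> R) : Prop :=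
  forall u : nat -> X,
    (forall e : R, 0 < e ->
       exists N : nat, forall m n : nat,
         (N <= m)%N -> (N <= n)%N -> d (u m) (u n) < e) ->
    exists l : X, u @ \oo --> l.

(* Being Polish is a property of the topology; the metric is not part of the
   data. The empty space is allowed. *)
Definition polish (R : realType) (X : topologicalType) : Prop :=
  (exists2 D : set X, countable D & dense D) /\
  (exists2 d : X -> X -> R, compatible_metric d & complete_metric d).

(* Not stated with [measurable_fun] because [g_sigma_algebraType] needs a
   pointed carrier. *)
Definition borel_map (X Y : topologicalType) (f : X -> Y) : Prop :=
  forall B : set Y, <<s @open Y >> B -> <<s @open X >> (f @^-1` B).

Definition nowhere_dense (X : topologicalType) (A : set X) : Prop :=
  interior (closure A) = set0.

Definition meager (X : topologicalType) (A : set X) : Prop :=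
  exists2 F : nat -> set X,
    (forall n, nowhere_dense (F n)) & A = \bigcup_n F n.

Definition baire_property (X : topologicalType) (A : set X) : Prop :=
  exists2 U : set X, open U & meager (A `+` U).

Definition group_action (G : groupType) (X : Type) (act : G -> X -> X) : Prop :=
  (forall x, act 1%g x = x) /\
  (forall (g h : G) x, act (g * h)%g x = act g (act h x)).

Definition pieces (X : Type) (n m : nat)
    (A : 'I_n -> set X) (B : 'I_m -> set X) (k : 'I_n + 'I_m) : set X :=
  match k with inl i => A i | inr j => B j end.

(* [classical_sets.partition] includes that the pieces are nonempty. *)
Definition paradoxical_decomposition (G : groupType) (X : Type)
    (act : G -> X -> X) (n m : nat)
    (A : 'I_n -> set X) (B : 'I_m -> set X)
    (alpha : 'I_n -> G) (beta : 'I_m -> G) : Prop :=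
  [/\ classical_sets.partition [set: 'I_n + 'I_m] (pieces A B) [set: X],
      trivIset [set: 'I_n] (fun i => act (alpha i) @` A i),
      trivIset [set: 'I_m] (fun j => act (beta j) @` B j),
      \bigcup_i (act (alpha i) @` A i) = [set: X] &
      \bigcup_j (act (beta j) @` B j) = [set: X]].

(* Main.v *)
(* Following Marks and Unger, join each point (x, b) of X * bool to finitely many
   translates t k x, products of two inverses of the group elements of the given
   decomposition; that decomposition shows that every finite set F of such points
   has at least 2|F| neighbours. Greedily match, at stage n, the unmatched points
   of a very sparse Borel set A n, each time with the first neighbour whose removal
   preserves Hall's condition. By sparseness, a connected F that loses several
   neighbours at stage n loses at most |F| / 2^(n+1) of them, so large connected
   sets keep the expansion 1 + 2^-n, and Hall's condition survives all stages.
   The sets A n can be chosen to cover the orbits in a comeager invariant Borel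
   set, where the matching is thus a Borel injection of X * bool into X. The
   Schroeder-Bernstein argument turns it into a decomposition with Borel pieces.
   On the meager complement the given decomposition is kept. *)
Require Import Defs.
From mathcomp Require Import all_boot all_order all_algebra.
From mathcomp Require Import all_classical all_reals all_analysis.
From mathcomp Require Import finmap zify.
Set Implicit Arguments.
Unset Strict Implicit.
Unset Printing Implicit Defensive.
Import Order.TTheory GRing.Theory Num.Theory.
Local Open Scope classical_set_scope.

(** * Hall's condition in locally finite bipartite graphs *)

Section BipartiteGraph.
Variables (L V : choiceType) (nb : L -> {fset V}).
Implicit Types (F : {fset L}) (D A : set L) (U : set V).

Definition nbs F : {fset V} := (\bigcup_(u <- F) nb u)%fset.

Definition free U F : {fset V} := [fset v in nbs F | ~~ `[<U v>]]%fset.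

Local Arguments nbs F%_fset_scope.
Local Arguments free U%_classical_set_scope F%_fset_scope.

Lemma nbsP v F : reflect (exists2 u, u \in F & v \in nb u) (v \in nbs F).
Proof.
apply: (iffP (bigfcupP _ _ _ _)) => [[u]|[u uF vu]].
  by rewrite andbT => uF vu; exists u.
by exists u; rewrite ?andbT.
Qed.

Lemma freeP U F v : (v \in free U F) <-> v \in nbs F /\ ~ U v.
Proof.
rewrite !inE /=; split=> [/andP[-> /asboolPn]|[-> nU]] //.
exact/asboolPn.
Qed.

Lemma nbsU F F' : nbs (F `|` F')%fset = (nbs F `|` nbs F')%fset.
Proof.
apply/fsetP => v; rewrite in_fsetU; apply/nbsP/orP.
- by case=> u; rewrite inE => /orP[] uF vu; [left|right]; apply/nbsP; exists u.
- by case=> /nbsP[u uF vu]; exists u => //; rewrite inE uF ?orbT.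
Qed.

Lemma freeU U F F' : free U (F `|` F')%fset = (free U F `|` free U F')%fset.
Proof. by apply/fsetP => v; rewrite !inE nbsU inE andb_orl. Qed.

Lemma free_sub U F F' : (F `<=` F')%fset -> (free U F `<=` free U F')%fset.
Proof. by move=> /fsetUidPr <-; rewrite freeU fsubsetUl. Qed.

Lemma freeUset U v F :
  free (U `|` [set v]) F = (free U F `\ v)%fset.
Proof.
apply/fsetP => w; rewrite in_fsetD1; apply/idP/andP.
- move=> /freeP[wF]; rewrite /= not_orP => -[nU nv]; split; first exact/eqP.
  exact/freeP.
- by move=> [/eqP wv /freeP[wF nU]]; apply/freeP; split=> // -[].
Qed.

Definition avoids D F := forall u, u \in F -> ~ D u.

(** [D] stands for the left vertices already matched and [U] for their partners, so this is Hall's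
    condition for the remaining graph. *)
Definition hall D U := forall F, avoids D F -> #|` F| <= #|` free U F|.

(* The sets [F] with [#|free U F| <= #|F|] are closed under union by
   submodularity; if every neighbour of [u] were a bad choice, a union of such
   sets would contain all free neighbours of [u]. *)
Lemma hall_choice D U u : hall D U -> ~ D u ->
  exists2 v, v \in nb u & ~ U v /\ hall (D `|` [set u]) (U `|` [set v]).
Proof.
move=> H Du; apply: contrapT => no.
have tight (s : seq V) : {subset s <= free U [fset u]} ->
    exists F, [/\ avoids (D `|` [set u]) F, #|` free U F| <= #|` F|
              & {subset s <= free U F}].
  elim: s => [_|v s IH sub].
    exists fset0; split=> //.
    suff -> : free U fset0 = fset0 by rewrite cardfs0.
    apply/fsetP => v; rewrite in_fset0; apply/negbTE/negP => /freeP[/nbsP[w]].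
    by rewrite in_fset0.
  case: IH => [w ws|F [avF leF sF]]; first by apply: sub; rewrite inE ws orbT.
  have /freeP[/nbsP[w /fset1P -> vu] nUv] : v \in free U [fset u].
    by apply: sub; rewrite inE eqxx.
  (* As [v] is a bad choice, some [F'] violates Hall's condition once [v] is removed. The condition
     held before, so [v] is a free neighbour of [F'] and [F'] is tight. *)
  have [F' avF' ltF'] : exists2 F', avoids (D `|` [set u]) F'
      & #|` free (U `|` [set v]) F'| < #|` F'|.
    apply: contrapT => nex; apply: no; exists v => //; split=> // F' avF'.
    by rewrite leqNgt; apply/negP => lt; apply: nex; exists F'.
  have avoidsDu K : avoids (D `|` [set u]) K -> avoids D K.
    by move=> avK z /avK nz Dz; apply: nz; left.
  have := H _ (avoidsDu _ avF').
  move: ltF'; rewrite freeUset => ltF' leF'.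
  have vF' : v \in free U F'.
    apply: contraT => /mem_fsetD1 E; rewrite E in ltF'.
    by move: leF'; rewrite leqNgt ltF'.
  have leF'2 : #|` free U F'| <= #|` F'|.
    by rewrite (cardfsD1 v) vF' add1n.
  exists (F `|` F')%fset; split.
  - by move=> z; rewrite inE => /orP[/avF|/avF'].
  - rewrite freeU.
    have avI : avoids D (F `&` F')%fset.
      by apply: avoidsDu => z; rewrite inE => /andP[/avF].
    have := H _ avI.
    have sI : (free U (F `&` F') `<=` free U F `&` free U F')%fset.
      by apply/fsubsetIP; split; apply: free_sub; rewrite ?fsubsetIl ?fsubsetIr.
    have := fsubset_leq_card sI.
    have := cardfsUI F F'; have := cardfsUI (free U F) (free U F').
    lia.
  - move=> z; rewrite freeU in_fsetU inE => /orP[/eqP ->|/sF ->//].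
    by rewrite vF' orbT.
have [F [avF leF sF]] := tight (enum_fset (free U [fset u])) (fun _ => id).
have uF : u \notin F by apply/negP => /avF; apply; right.
have avuF : avoids D (u |` F)%fset.
  move=> z; rewrite !inE => /orP[/eqP -> //|/avF nz Dz].
  by apply: nz; left.
(* Adding [u] to [F] brings no new free neighbour, so Hall's condition for the enlarged set
   contradicts the tightness of [F]. *)
have := H _ avuF; rewrite freeU.
have /fsetUidPr -> : (free U [fset u] `<=` free U F)%fset by apply/fsubsetP.
by rewrite cardfsU1 uF => /leq_trans/(_ leF); rewrite add1n ltnn.
Qed.

(** * Distance, sparse sets and connected sets in the graph of common neighbours *)

Definition share u w := exists2 v, v \in nb u & v \in nb w.

Fixpoint near (r : nat) (u w : L) : Prop :=
  if r is r'.+1 then near r' u w \/ exists2 z, near r' u z & share z w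
  else u = w.

Lemma near_trans r r' u w z : near r u w -> near r' w z -> near (r + r') u z.
Proof.
elim: r' z => [|r' IH] z /= uw.
  by move=> <-; rewrite addn0.
rewrite addnS /=; case=> [wz|[y wy yz]]; first by left; apply: IH.
by right; exists y => //; apply: IH.
Qed.

Lemma share_near u w : share u w -> near 1 u w.
Proof. by move=> uw; right; exists u. Qed.

Lemma share_sym u w : share u w -> share w u.
Proof. by case=> v; exists v. Qed.

Lemma near_sym r u w : near r u w -> near r w u.
Proof.
elim: r w => [|r IH] w /=; first by move=> ->.
case=> [/IH|[z /IH zu zw]]; first by left.
by rewrite -/(near r.+1 w u) -add1n;
  apply: near_trans zu; apply/share_near/share_sym.
Qed.

Lemma near_leq r r' u w : r <= r' -> near r u w -> near r' u w.
Proof.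
move=> /subnK <-; elim: (r' - r) => [|k IH] // /IH nk.
by rewrite addSn; left.
Qed.

Definition sparse r A := forall u w, A u -> A w -> near r u w -> u = w.

(* Connectedness of [F] in the graph joining vertices with a common neighbour. *)
Definition connected F := forall F1, (F1 `<=` F)%fset -> F1 != fset0 ->
  [disjoint nbs F1 & nbs (F `\` F1)]%fset -> F1 = F.

(* The balls in [F] around [w]: a stationary ball shares no neighbour with its
   complement, so it is all of [F]. *)
Lemma connected_ball F w r : connected F -> w \in F ->
  exists B, [/\ (B `<=` F)%fset, w \in B, (forall u, u \in B -> near r w u) &
    B = F \/ r < #|` B|].
Proof.
move=> cF wF; elim: r => [|r [B [BF wB Bn cB]]].
  exists [fset w]%fset; split; rewrite ?fsub1set ?fset11 //.
    by move=> u /fset1P ->.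
  by right; rewrite cardfs1.
pose B' := (B `|` [fset u in F | nb u `&` nbs B != fset0])%fset.
exists B'; split.
- by rewrite fsubUset BF; apply/fsubsetP => u; rewrite !inE => /andP[].
- by rewrite inE wB.
- move=> u; rewrite !inE => /orP[/Bn|/andP[uF /fset0Pn[v]]]; first by left.
  by rewrite inE => /andP[vu /nbsP[z /Bn nz vz]]; right; exists z => //; exists v.
- have B'F : (B' `<=` F)%fset.
    by rewrite fsubUset BF; apply/fsubsetP => u; rewrite !inE => /andP[].
  have BB' : (B `<=` B')%fset by rewrite fsubsetUl.
  case: cB => [BeqF|rB].
    by left; apply/eqP; rewrite eqEfsubset B'F -{1}BeqF BB'.
  have [B'B|/eqP B'B] := eqVneq B' B; last first.
    right; apply: leq_ltn_trans rB _; apply: fproper_ltn_card.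
    by rewrite fproperEneq BB' andbT eq_sym; apply/eqP.
  left; rewrite B'B; apply: cF => //; first by apply/fset0Pn; exists w.
  apply/fdisjointP => v vB; apply/negP => /nbsP[u].
  rewrite inE => /andP[uB uF] vu.
  suff : u \in B' by rewrite B'B (negbTE uB).
  rewrite !inE uF (negbTE uB) /=; apply/fset0Pn; exists v.
  by rewrite inE vu.
Qed.

Lemma card_disjoint_family (W : {fset V}) (B : V -> {fset L}) F q :
  (forall v, v \in W -> B v `<=` F /\ q <= #|` B v|)%fset ->
  (forall v v' u, v \in W -> v' \in W -> u \in B v -> u \in B v' -> v = v') ->
  #|` W| * q <= #|` F|.
Proof.
elim/fset1U_rect: W F => [|v W vW IH] F HB dB; first by rewrite cardfs0.
have [BF qB] := HB v (fset1U1 _ _).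
rewrite cardfsU1 vW add1n mulSn.
have := cardfsID (B v) F; rewrite (fsetIidPr BF) => <-.
rewrite leq_add //; apply: IH => [v' v'W|v1 v2 u v1W v2W].
  have [BF' ->] := HB v' (fset1Ur _ v'W); split=> //.
  apply/fsubsetP => u uv'; rewrite inE (fsubsetP BF' u uv') andbT.
  apply/negP => uv; move: vW; rewrite (dB v v' u) ?v'W //.
    exact: fset1U1.
  exact: fset1Ur.
by apply: dB; exact: fset1Ur.
Qed.

Definition taken U (c : L -> V) A F : {fset V} :=
  [fset v in free U F | `[<exists2 u, A u & c u = v>]]%fset.

(** Each taken vertex is adjacent to a point of [F] at distance at most 1 from [A]. Sparseness keeps
    these points so far apart that their balls of radius [q - 1] in [F] are disjoint, and by
    connectedness each ball has at least [q] points. *)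
Lemma taken_card U c A F q : 0 < q -> connected F ->
  (forall u, A u -> c u \in nb u) -> sparse (q + q) A ->
  1 < #|` taken U c A F| -> #|` taken U c A F| * q <= #|` F|.
Proof.
move=> q0 cF cnb sA T1; set W := taken U c A F.
have WP v : v \in W -> exists w, [/\ w \in F, v \in nb w &
    exists u, A u /\ c u = v].
  rewrite !inE => /andP[/andP[/nbsP[w wF vw] _] /asboolP[u Au cu]].
  by exists w; split=> //; exists u.
have [w0 _] : exists w0, w0 \in F.
  move: T1; rewrite -/W => /ltnW; rewrite cardfs_gt0 => /fset0Pn[z /WP[w [wF _ _]]].
  by exists w.
have {}WP v : exists w, v \in W -> [/\ w \in F, v \in nb w &
    exists u, A u /\ c u = v].
  by have [/WP[w]|_] := boolP (v \in W); [exists w|exists w0].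
have [w wP] := choice WP.
(* The distances add up to [1 + 2(q - 1) + 1 = 2q], the range of [sparse]. *)
have far v v' : v \in W -> v' \in W -> near (q.-1 + q.-1) (w v) (w v') -> v = v'.
  move=> /wP[_ vw [u [Au cu]]] /wP[_ vw' [u' [Au' cu']]] n.
  have uw : near 1 u (w v).
    by apply: share_near; exists v; rewrite // -cu; apply: cnb.
  have uw' : near 1 (w v') u'.
    by apply: share_near; exists v'; rewrite // -cu'; apply: cnb.
  rewrite -cu -cu'; congr c; apply: sA => //.
  apply: near_leq (near_trans (near_trans uw n) uw'); lia.
have bP v : exists B, v \in W -> [/\ (B `<=` F)%fset,
    forall u, u \in B -> near q.-1 (w v) u & q <= #|` B|].
  have [vW|_] := boolP (v \in W); last by exists fset0.
  have [wF vw _] := wP _ vW.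
  have [B [BF wB Bn cB]] := connected_ball q.-1 cF wF.
  exists B => _; split=> //; case: cB => [BE|]; last by rewrite prednK.
  (* The ball is not all of [F]: a second taken vertex [v'] exists, and [w v'] lies in [F] beyond
     the radius. *)
  exfalso; move: T1; rewrite -/W (cardfsD1 v) vW ltnS.
  rewrite cardfs_gt0 => /fset0Pn[v']; rewrite !in_fsetD1 => /andP[/eqP v'v v'W].
  have [wF' _ _] := wP _ v'W.
  apply: v'v; apply: far => //; apply: near_sym.
  by apply: near_leq (Bn _ _); [exact: leq_addr|rewrite BE].
have [B BP] := choice bP.
apply: (card_disjoint_family (B := B)).
  by move=> v /BP[].
move=> v v' u vW v'W uB uB'; apply: far => //.
have [_ n _] := BP _ vW; have [_ n' _] := BP _ v'W.
exact: near_trans (n _ uB) (near_sym (n' _ uB')).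
Qed.

(** Expansion by the factor [1 + 2^-n] with denominators cleared; at [n = 0] it is a doubling for
    all nonempty connected sets avoiding [D]. *)
Definition expands n D U := forall F, connected F -> avoids D F ->
  2 ^ n <= #|` F| -> (2 ^ n).+1 * #|` F| <= 2 ^ n * #|` free U F|.

(** * One stage of the matching *)

Section Step.
Variables (D A : set L) (U : set V) (c : L -> V) (n : nat).
Hypotheses (hallDU : hall D U) (expDU : expands n D U).
Hypotheses (sparseA : sparse (2 ^ n.+2) A) (cnb : forall u, A u -> c u \in nb u).
Hypothesis hallA :
  forall u, A u -> hall (D `|` [set u]) (U `|` [set c u]).

Let U' := U `|` [set c u | u in A].

Let free_step F : free U' F = (free U F `\` taken U c A F)%fset.
Proof.
apply/fsetP => v; rewrite in_fsetD; apply/idP/andP => [/freeP[vF nU]|[nv /freeP[vF nU]]].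
  split; last by apply/freeP; split=> // Uv; apply: nU; left.
  by apply/negP; rewrite inE => /andP[_ /asboolP[u Au cu]]; apply: nU; right; exists u.
apply/freeP; split=> // -[//|[u Au cu]]; move/negP: nv; apply; rewrite inE.
apply/andP; split; first exact/freeP.
by apply/asboolP; exists u.
Qed.

Let card_step F : #|` free U' F| + #|` taken U c A F| = #|` free U F|.
Proof.
rewrite free_step cardfsDS ?subnK ?fsubset_leq_card //;
by apply/fsubsetP => v; rewrite inE => /andP[].
Qed.

Let takenP F : connected F -> 1 < #|` taken U c A F| ->
  #|` taken U c A F| * 2 ^ n.+1 <= #|` F|.
Proof.
move=> cF; apply: taken_card => //; first by rewrite expn_gt0.
by rewrite addnn -mul2n -expnS.
Qed.

Let avoidsD F : avoids (D `|` A) F -> avoids D F.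
Proof. by move=> av z /av nz Dz; apply: nz; left. Qed.

(** The loss is at most [#|F| / 2^(n+1)]: by [takenP] if several vertices are taken, and by the size
    bound on [F] if at most one is. Subtracting it from the factor [1 + 2^-n] leaves
    [1 + 2^-(n+1)]. *)
Lemma expands_step : expands n.+1 (D `|` A) U'.
Proof.
move=> F cF /avoidsD avF leF.
have := expDU cF avF; have := card_step F; have := takenP cF.
move: leF; rewrite expnS; set p := 2 ^ n; set t := #|` taken _ _ _ _|.
move: #|` F| #|` free U F| #|` free U' F| => a b b'.
have : 0 < p by rewrite expn_gt0.
case: (ltngtP t 1) => ht; nia.
Qed.

(* A counterexample of least size is connected. If it meets only one new vertex
   [c u] then [hallA] applies; if it meets more, [takenP] shows that it is large
   and that [expDU] leaves room for the loss. *)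
Lemma hall_step : hall (D `|` A) U'.
Proof.
move=> F; move: {2}#|` F| (leqnn #|` F|) => k; elim: k F => [|k IH] F.
  by rewrite leqn0 => /eqP ->.
move=> Fk avF.
(* A disconnected [F] splits into two smaller sets with disjoint neighbourhoods, whose inequalities
   add up. *)
have [cF|ncF] := pselect (connected F); last first.
  have [F1 [F1F F10 dis F1nF]] : exists F1, [/\ (F1 `<=` F)%fset, F1 != fset0,
      [disjoint nbs F1 & nbs (F `\` F1)]%fset & F1 <> F].
    apply: contrapT => nex; apply: ncF => F1 F1F F10 dis.
    by apply: contrapT => nE; apply: nex; exists F1.
  have ltF1 : #|` F1| < #|` F|.
    by apply: fproper_ltn_card; rewrite fproperEneq F1F andbT; apply/eqP.
  have F1gt : 0 < #|` F1| by rewrite cardfs_gt0.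
  have cD := cardfsDS F1F.
  have h1 : #|` F1| <= #|` free U' F1|.
    by apply: IH; [lia|move=> z /(fsubsetP F1F)/avF].
  have h2 : #|` F `\` F1|%fset <= #|` free U' (F `\` F1)%fset|.
    by apply: IH; [lia|move=> z; rewrite inE => /andP[_ /avF]].
  have := cardfsUI (free U' F1) (free U' (F `\` F1)%fset).
  rewrite -freeU fsetUDl fsetDv fsetD0 (elimT (fsetUidPr _ _) F1F).
  suff -> : (free U' F1 `&` free U' (F `\` F1) = fset0)%fset.
    by rewrite cardfs0; lia.
  apply/fsetP => v; rewrite in_fsetI in_fset0; apply/negbTE/negP => /andP[].
  move=> /freeP[v1 _] /freeP[v2 _].
  by move/fdisjointP/(_ v v1): dis; rewrite v2.
have fF := hallDU (avoidsD avF); have cs := card_step F.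
case: (ltngtP #|` taken U c A F| 1) => [t1|t1|/eqP/cardfs1P[v tv]].
- lia.
- have := takenP cF t1; have := expDU cF (avoidsD avF).
  rewrite expnS; set p := 2 ^ n; move: t1 cs; set t := #|` taken _ _ _ _|.
  move: #|` F| #|` free U F| #|` free U' F| => a b b'.
  have : 0 < p by rewrite expn_gt0.
  by move=> p0 t2 cs h tp; have {}h := h ltac:(nia); nia.
- have : v \in taken U c A F by rewrite tv fset11.
  rewrite inE => /andP[_ /asboolP[u Au cu]].
  have := hallA Au; rewrite cu => /(_ F); rewrite freeUset free_step tv; apply.
  by move=> z /avF nz [Dz|zu]; apply: nz; [left|right; rewrite zu].
Qed.

End Step.
End BipartiteGraph.

(** * Baire property and Borel sets *)

Section Baire.
Variable X : topologicalType.
Implicit Types A B : set X.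

Lemma nowhere_denseS A B : A `<=` B -> nowhere_dense B -> nowhere_dense A.
Proof.
move=> AB; rewrite /nowhere_dense => B0; rewrite -subset0 -B0.
exact/interiorS/closureS.
Qed.

Lemma meagerS A B : A `<=` B -> meager B -> meager A.
Proof.
move=> AB [F nF BE]; exists (fun n => A `&` F n).
  by move=> n; apply: nowhere_denseS (nF n) => x [].
by rewrite -setI_bigcupr -BE; apply/esym/setIidPl.
Qed.

Lemma meager_bigcup (I : countType) (A : I -> set X) :
  (forall i, meager (A i)) -> meager [set x | exists i, A i x].
Proof.
move=> mA; have /choice[F FP] : forall i, exists F : nat -> set X,
    (forall n, nowhere_dense (F n)) /\ A i = \bigcup_n F n.
  by move=> i; have [F] := mA i; exists F.
exists (fun n => if (choice.unpickle n : option (I * nat)) is Some (i, m) then F i m else set0).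
  move=> n; case: choice.unpickle => [[i m]|]; first by have [] := FP i.
  by rewrite /nowhere_dense closure0 interior0.
apply/seteqP; split=> [x [i]|x [n _]].
  have [_ ->] := FP i; move=> [m _ Fx].
  by exists (choice.pickle (i, m)) => //; rewrite choice.pickleK.
case: choice.unpickle => [[i m] Fx|//]; exists i.
by have [_ ->] := FP i; exists m.
Qed.

Lemma meagerU A B : meager A -> meager B -> meager (A `|` B).
Proof.
move=> mA mB; apply: (@meagerS _ [set x | exists b : bool, (if b then A else B) x]).
  by move=> x [Ax|Bx]; [exists true|exists false].
by apply: meager_bigcup => -[].
Qed.

Lemma meager0 : meager (@set0 X).
Proof.
exists (fun=> set0) => [_|]; last by rewrite bigcup0.
by rewrite /nowhere_dense closure0 interior0.
Qed.

Lemma nowhere_dense_boundary (U : set X) :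
  open U -> nowhere_dense (closure U `\` U).
Proof.
move=> oU; rewrite /nowhere_dense -subset0 => x xi.
have cB : closed (closure U `\` U).
  by apply: closedI; [exact: closed_closure|rewrite closedC].
have [xU nUx] : (closure U `\` U) x.
  by rewrite {1}(iffLR (closure_id _) cB); apply: interior_subset.
move: xi; rewrite -(iffLR (closure_id _) cB) => xi.
by have [y [Uy [_ /(_ Uy)]]] := xU _ xi.
Qed.

(** The exterior of [U] approximates the complement of [A]; the extra error is the boundary of [U],
    which is nowhere dense. *)
Lemma baire_propertyC A : baire_property A -> baire_property (~` A).
Proof.
move=> [U oU mU]; exists (~` closure U); first by rewrite openC; exact: closed_closure.
apply: (@meagerS _ ((A `+` U) `|` (closure U `\` U))).
  move=> x; rewrite /setY /= => -[[nA /contrapT cU]|[ncU /contrapT Ax]].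
    have [Ux|nUx] := pselect (U x); last by right.
    by left; right.
  by left; left; split=> // /subset_closure.
apply: meagerU => //; exists (fun=> closure U `\` U).
  by move=> _; exact: nowhere_dense_boundary.
by apply/seteqP; split=> [x|x [] //]; exists 0.
Qed.

Lemma baire_property_bigcup (A : nat -> set X) :
  (forall n, baire_property (A n)) -> baire_property (\bigcup_n A n).
Proof.
move=> bA; have /choice[U UP] : forall n, exists U, open U /\ meager (A n `+` U).
  by move=> n; have [U] := bA n; exists U.
exists (\bigcup_n U n); first by apply: bigcup_open => n _; case: (UP n).
apply: (@meagerS _ [set x | exists n, (A n `+` U n) x]); last first.
  by apply: meager_bigcup => n; case: (UP n).
move=> x [[[n _ Ax] nU]|[[n _ Ux] nA]]; exists n.
  by left; split=> // h; apply: nU; exists n.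
by right; split=> // h; apply: nA; exists n.
Qed.

Lemma open_baire_property A : open A -> baire_property A.
Proof. by move=> oA; exists A => //; apply: meagerS (meager0) => x [[]|[]]. Qed.

Definition borel A := <<s @open X >> A.

Lemma borel_baire_property A : borel A -> baire_property A.
Proof.
move: A; apply: (@smallest_sub _ (sigma_algebra setT) open (@baire_property X));
  last exact: open_baire_property.
split=> [|B|F]; first by apply: open_baire_property; exact: open0.
- by rewrite setTD; exact: baire_propertyC.
- exact: baire_property_bigcup.
Qed.

Lemma meager_baire_property A : meager A -> baire_property A.
Proof. by move=> mA; exists set0; [exact: open0|apply: meagerS mA => x [[]|[]]]. Qed.

Lemma borel_open A : open A -> borel A.
Proof. exact: sub_sigma_algebra. Qed.

Lemma borel_not A : borel A -> borel [set x | ~ A x].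
Proof. by rewrite -[X in _ -> borel X]/(~` A) -setTD; exact: sigma_algebraCD. Qed.

Lemma borel_ex (I : countType) (A : I -> set X) :
  (forall i, borel (A i)) -> borel [set x | exists i, A i x].
Proof.
move=> bA; suff -> : [set x | exists i, A i x] =
    \bigcup_n (if (choice.unpickle n : option I) is Some i then A i else set0).
  apply: sigma_algebra_bigcup => n; case: choice.unpickle => [i|]; first exact: bA.
  exact: sigma_algebra0.
apply/seteqP; split=> [x [i Ax]|x [n _]].
  by exists (choice.pickle i) => //; rewrite choice.pickleK.
by case: choice.unpickle => // i Ax; exists i.
Qed.

Lemma borel_all (I : countType) (A : I -> set X) :
  (forall i, borel (A i)) -> borel [set x | forall i, A i x].
Proof.
move=> bA; suff -> : [set x | forall i, A i x] = [set x | ~ exists i, ~ A i x].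
  by apply: borel_not; apply: borel_ex => i; exact: borel_not.
apply/seteqP; split=> x /= h; first by case=> i; apply.
by move=> i; apply: contrapT => nA; apply: h; exists i.
Qed.

Lemma borel_or A B : borel A -> borel B -> borel [set x | A x \/ B x].
Proof.
move=> bA bB; suff -> : [set x | A x \/ B x] =
    [set x | exists b : bool, (if b then A else B) x].
  by apply: borel_ex => -[].
apply/seteqP; split=> [x [Ax|Bx]|x [[]]]; first by exists true.
- by exists false.
- by left.
- by right.
Qed.

Lemma borel_and A B : borel A -> borel B -> borel [set x | A x /\ B x].
Proof.
move=> bA bB; suff -> : [set x | A x /\ B x] =
    [set x | forall b : bool, (if b then A else B) x].
  by apply: borel_all => -[].
apply/seteqP; split=> [x [Ax Bx] []//|x h].
by split; [exact: (h true)|exact: (h false)].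
Qed.

Lemma borel_imp (A B : set X) : borel A -> borel B -> borel [set x | A x -> B x].
Proof.
move=> bA bB; suff -> : [set x | A x -> B x] = [set x | ~ A x \/ B x].
  by apply: borel_or => //; exact: borel_not.
apply/seteqP; split=> x; last by move=> [nA Ax|Bx _ //]; case: (nA Ax).
by move=> AB; have [Ax|] := pselect (A x); [right; exact: AB|left].
Qed.

Lemma borel_cst (P : Prop) : borel [set x | P].
Proof.
have [p|np] := pselect P.
  suff -> : [set x : X | P] = setT by apply: borel_open; exact: openT.
  by apply/seteqP; split.
suff -> : [set x : X | P] = set0 by apply: borel_open; exact: open0.
by apply/seteqP; split.
Qed.

End Baire.

Lemma polish_countable_base (R : realType) (X : topologicalType) :
  polish R X -> exists2 W : nat * nat -> set X, (forall i, open (W i)) &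
    forall x A, nbhs x A -> exists2 i, W i x & W i `<=` A.
Proof.
move=> [[D /countable_injP[f finj] dD] [d [[d0 dsym dtri] dnb] _]].
pose W (i : nat * nat) := [set y | exists z,
  [/\ D z, f z = i.1 & (d z y < (i.2.+1)%:R^-1)%R]].
have dball z (e : R) : open [set y | (d z y < e)%R].
  rewrite openE => y /= zy; apply/dnb; exists (e - d z y)%R.
    by rewrite subr_gt0.
  move=> w /= yw; apply: le_lt_trans (dtri z y w) _.
  by rewrite -ltrBrDl.
exists W => [i|x A /dnb[e e0 eA]].
  suff -> : W i = \bigcup_(z in [set z | D z /\ f z = i.1])
      [set y | (d z y < (i.2.+1)%:R^-1)%R] by apply: bigcup_open.
  apply/seteqP; split=> y; first by case=> z [Dz fz zy]; exists z.
  by case=> z [Dz fz] zy; exists z.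
have [n ne] : exists n, ((n.+1)%:R^-1 < e / 2)%R.
  have e2 : (0 < e / 2)%R by rewrite divr_gt0.
  have := @near_infty_natSinv_lt R (PosNum e2).
  by move=> [n _ /(_ n (leqnn n))]; exists n.
have [z [/= xz Dz]] : [set y | (d x y < (n.+1)%:R^-1)%R] `&` D !=set0.
  apply: dD => //; exists x => /=; rewrite (iffRL (d0 x x)) //.
exists (f z, n); first by exists z; split=> //; rewrite dsym.
move=> y [z' [/= Dz' fz zy]]; apply: eA => /=.
have zz : z' = z by apply: finj => //; exact/mem_set.
rewrite zz in zy.
apply: le_lt_trans (dtri x z y) _; rewrite (splitr e).
by apply: ltrD; apply: lt_trans ne.
Qed.

Lemma polish_accessible (R : realType) (X : topologicalType) (x y : X) :
  polish R X -> x <> y -> nbhs x [set z | z <> y].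
Proof.
move=> [_ [d [[d0 dsym dtri] dnb] _]] xy; apply/dnb; exists (d x y); last first.
  by move=> z /= zx zy; move: zx; rewrite zy ltxx.
(* Positivity comes from [0 = d x x <= 2 d x y] together with [x <> y]. *)
have := dtri x y x; rewrite (iffRL (d0 x x)) // (dsym y x) -mulr2n pmulrn_lge0 //.
by rewrite le_eqVlt => /orP[/eqP/esym/d0|].
Qed.

(** * Sparse Borel sets covering generic orbits *)

(** Enumerates the generated subgroup by evaluating words in the [g k] and their inverses; numbers
    coding no word give the empty word. Countability turns quantifiers over an orbit into Borel
    operations. *)
Lemma countable_closure (G : groupType) (K : countType) (g : K -> G) :
  exists e : nat -> G, [/\ exists i, e i = 1%g,
    forall i j, exists k, e k = (e i * e j)%g,
    forall i, exists j, e j = (e i)^-1%g & forall k, exists i, e i = g k].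
Proof.
pose letter (p : bool * K) := if p.1 then g p.2 else (g p.2)^-1%g.
pose ev (w : seq (bool * K)) := foldr (fun p h => letter p * h)%g 1%g w.
have evP w : exists i, ev (odflt [::] (choice.unpickle i)) = ev w.
  by exists (choice.pickle w); rewrite choice.pickleK.
have ev_cat w w' : ev (w ++ w') = (ev w * ev w')%g.
  by elim: w => [|p w IH] /=; rewrite ?mul1g // IH mulgA.
exists (fun i => ev (odflt [::] (choice.unpickle i))); split.
- exact: (evP [::]).
- by move=> i j; rewrite -ev_cat.
- move=> i; move: (odflt _ _) => w.
  suff [w' <-] : exists w', ev w' = (ev w)^-1%g by [].
  elim: w => [|p w [w' IH]]; first by exists [::]; rewrite /= invg1.
  exists (w' ++ [:: (~~ p.1, p.2)]); rewrite ev_cat IH /= invgM mulg1.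
  by congr (_ * _)%g; case: p => [[] k]; rewrite /letter /= ?invgK.
- move=> k; have [i ei] := evP [:: (true, k)].
  by exists i; rewrite ei /= mulg1.
Qed.

Lemma borel_all_seq (X : topologicalType) (I : eqType) (s : seq I)
    (A : I -> set X) :
  (forall i, borel (A i)) -> borel [set x | forall i, i \in s -> A i x].
Proof.
move=> bA; elim: s => [|i s IH].
  suff -> : [set x | forall i, i \in [::] -> A i x] = [set x | True].
    exact: borel_cst.
  by apply/seteqP; split.
suff -> : [set x | forall j, j \in i :: s -> A j x] =
    [set x | A i x /\ [set x | forall j, j \in s -> A j x] x].
  exact: borel_and.
apply/seteqP; split=> x /= h.
  by split=> [|j js]; apply: h; rewrite inE ?eqxx ?js ?orbT.
by move=> j; rewrite inE => /orP[/eqP ->|]; [case: h|case: h => _; apply].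
Qed.

Lemma nbhs_all_seq (X : topologicalType) (I : eqType) (s : seq I)
    (A : I -> set X) (x : X) :
  (forall i, i \in s -> nbhs x (A i)) ->
  nbhs x [set y | forall i, i \in s -> A i y].
Proof.
elim: s => [|i s IH] h; first exact: (@filterS _ (nbhs x) _ setT _ _ filterT).
have hi : nbhs x (A i) by apply: h; rewrite inE eqxx.
have hs : nbhs x [set y | forall i, i \in s -> A i y].
  by apply: IH => j js; apply: h; rewrite inE js orbT.
apply: filterS (filterI hi hs) => y [Ay sy] j; rewrite inE => /orP[/eqP ->//|].
exact: sy.
Qed.

Section GroupAction.
Variables (G : groupType) (X : topologicalType) (act : G -> X -> X).
Hypothesis act_action : group_action act.

Lemma actM g h x : act (g * h)%g x = act g (act h x).
Proof. by case: act_action. Qed.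

Lemma act1 x : act 1%g x = x.
Proof. by case: act_action. Qed.

Lemma actK g x : act g^-1%g (act g x) = x.
Proof. by rewrite -actM mulVg act1. Qed.

Lemma actVK g x : act g (act g^-1%g x) = x.
Proof. by rewrite -actM mulgV act1. Qed.

Hypothesis act_borel : forall g, borel_map (act g).
Variables (I : countType) (W : I -> set X).
Hypothesis W_open : forall i, open (W i).
Hypothesis W_base :
  forall x A, nbhs x A -> exists2 i, W i x & W i `<=` A.
Hypothesis X_accessible :
  forall x y : X, x <> y -> nbhs x [set z | z <> y].

Lemma borel_act g (A : set X) : borel A -> borel [set x | A (act g x)].
Proof. exact: act_borel. Qed.

(** Points are separated by the countable base: they differ iff some [W i] contains the first but
    not the second. *)
Lemma borel_eq g h : borel [set x | act g x = act h x].
Proof.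
suff -> : [set x | act g x = act h x] =
    [set x | ~ exists i, W i (act g x) /\ ~ W i (act h x)].
  apply: borel_not; apply: borel_ex => i.
  apply: borel_and; last apply: borel_not; apply: borel_act; exact: borel_open.
apply/seteqP; split=> x /=; first by move=> -> [i [Wi nWi]]; exact: nWi.
move=> nex; apply: contrapT => /X_accessible/W_base[i Wi sub].
by apply: nex; exists i; split=> // /sub.
Qed.

(* The action need not preserve meagerness, so a comeager set may contain no
   comeager invariant set, and a bad choice of one index per [n] cannot be
   repaired by discarding a meager set. The indices are instead chosen one at a
   time, so that every pullback [act (e i) @^-1` A n], over suitable [n], is
   nonmeager in each basic nonmeager open set. *)
Lemma generic_cover (e : nat -> G) (B : nat -> I -> set X) :
  (forall n i, borel (B n i)) -> (forall n x, exists i, B n i x) ->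
  exists A : nat -> set (X * bool),
    [/\ forall n b, borel [set x | A n (x, b)],
        forall n u w, A n u -> A n w ->
          u.2 = w.2 /\ exists i, B n i u.1 /\ B n i w.1 &
        meager [set x | ~ forall i b, exists n, A n (act (e i) x, b)]].
Proof.
move=> bB covB.
(* Each [n] codes one task [(i, j, b)]: make the pullback under [e i] of the [b]-copy of [A n]
   nonmeager in [W j]. Countably many [B n s] cover [X], so some [s] does this whenever [W j] is
   nonmeager. *)
have sP (n : nat) : exists p : option I * bool,
    forall i j b, n = choice.pickle (i, j, b) ->
    p.2 = b /\ (~ meager (W j) -> exists2 s, p.1 = Some s &
      ~ meager (W j `&` [set x | B n s (act (e i) x)])).
  case E : (choice.unpickle n : option (nat * I * bool)) => [[[i j] b]|]; last first.
    by exists (None, true) => i j b nE; rewrite nE choice.pickleK in E.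
  have [mW|nmW] := pselect (meager (W j)).
    exists (None, b) => i' j' b' nE; rewrite nE choice.pickleK in E.
    by case: E => _ -> ->; split.
  have [s nms] : exists s, ~ meager (W j `&` [set x | B n s (act (e i) x)]).
    apply: contrapT => nex; apply: nmW.
    apply: meagerS (meager_bigcup (A := fun s =>
        W j `&` [set x | B n s (act (e i) x)]) _) => [x Wx|s].
      by have [s Bs] := covB n (act (e i) x); exists s.
    by apply: contrapT => nm; apply: nex; exists s.
  exists (Some s, b) => i' j' b' nE; rewrite nE choice.pickleK in E.
  by case: E => -> -> ->; split=> // _; exists s.
have [p pP] := choice sP.
pose A n := [set u : X * bool | (exists s, (p n).1 = Some s /\ B n s u.1) /\
  u.2 = (p n).2].
have bA n b : borel [set x | A n (x, b)].
  rewrite /A /=; apply: borel_and; last exact: borel_cst.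
  by apply: borel_ex => s; apply: borel_and; [exact: borel_cst|exact: bB].
exists A; split=> // [n u w [[s [ps Bu]] ->] [[s' [ps' Bw]] ->]|].
  split=> //; exists s; split=> //.
  by move: ps'; rewrite ps => -[->].
pose M ib := [set x : X | ~ exists n, A n (act (e ib.1) x, ib.2)].
apply: (@meagerS _ _ [set x | exists ib, M ib x]).
  move=> x /= nall; apply: contrapT => nex; apply: nall => i b.
  by apply: contrapT => nA; apply: nex; exists (i, b).
apply: meager_bigcup => -[i b].
have bM : borel (M (i, b)).
  by apply: borel_not; apply: borel_ex => n; exact: (@borel_act (e i) [set y | A n (y, b)]).
(* If [U] were nonmeager, it would contain a nonmeager [W j]. The task [(i, j, b)] then puts a
   nonmeager part of [W j] outside [M (i, b)], although [M (i, b)] and [U] differ by a meager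
   set. *)
have [U oU mU] := borel_baire_property bM.
have UE : U = [set x | exists j, (if `[<W j `<=` U>] then W j else set0) x].
  apply/seteqP; split=> x.
    move=> Ux; have [j Wj sub] := W_base (open_nbhs_nbhs (conj oU Ux)).
    by exists j; case: asboolP.
  by case=> j; case: asboolP => // sub /sub.
suff mU' : meager U.
  apply: meagerS (meagerU mU mU') => x Mx.
  by have [Ux|nUx] := pselect (U x); [right|left; left].
rewrite UE; apply: meager_bigcup => j.
case: asboolP => [sub|_]; last exact: meager0.
apply: contrapT => nmW.
have [pb /(_ nmW)[s ps]] := pP (choice.pickle (i, j, b)) _ _ _ erefl.
apply; apply: meagerS mU => x [Wx Bx]; right; split; first exact: sub.
by move=> nA; apply: nA; exists (choice.pickle (i, j, b)); split=> //; exists s.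
Qed.


(** * Borel matching *)

Variables (T : finType) (t : T -> G) (e : nat -> G).
Hypothesis e_one : exists i, e i = 1%g.
Hypothesis e_mul : forall i j, exists k, e k = (e i * e j)%g.
Hypothesis e_inv : forall i, exists j, e j = (e i)^-1%g.
Hypothesis e_t : forall k, exists i, e i = t k.

Local Notation vtx := (X * bool)%type.

Definition trans_nb (u : vtx) : {fset X} := [fset act (t k) u.1 | k in T]%fset.
Local Notation nb := trans_nb.

Lemma trans_nbP v u : v \in nb u <-> exists k, v = act (t k) u.1.
Proof.
split=> [/imfsetP[k _ ->]|[k ->]]; first by exists k.
by apply/imfsetP; exists k.
Qed.

(** If [z] and [w] share the neighbour [act (t k) z = act (t l) w], then [w] is the translate of [z]
    by [(t l)^-1 * t k]. So finitely many group elements account for each ball. *)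
Fixpoint near_words r : seq G :=
  if r is r'.+1 then near_words r' ++
    [seq ((t kl.2)^-1 * t kl.1 * q)%g | kl <- enum {: T * T}, q <- near_words r']
  else [:: 1%g].

Lemma near_wordsP r u w : near nb r u w ->
  exists2 q, q \in near_words r & w.1 = act q u.1.
Proof.
elim: r w => [|r IH] w /=.
  by move=> ->; exists 1%g; rewrite ?inE ?act1.
case=> [/IH[q qr wq]|[z /IH[q qr zq] [v /trans_nbP[k vk] /trans_nbP[l vl]]]].
  by exists q; rewrite // mem_cat qr.
exists ((t l)^-1 * t k * q)%g.
  rewrite mem_cat; apply/orP; right.
  by apply/allpairsP; exists ((k, l), q); split; rewrite ?mem_enum.
by rewrite !actM -zq -vk vl actK.
Qed.

Definition isolated r i : set X := [set x | W i x /\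
  forall q, q \in near_words r -> act q x = x \/ ~ W i (act q x)].

Lemma borel_isolated r i : borel (isolated r i).
Proof.
apply: borel_and; first exact: borel_open.
apply: borel_all_seq => q; apply: borel_or.
  have E : [set x | act q x = x] = [set x | act q x = act 1%g x].
    by apply/seteqP; split=> x /=; rewrite act1.
  exact: (eq_ind_r (@borel X) (borel_eq q 1%g) E).
by apply: borel_not; apply: borel_act; exact: borel_open.
Qed.

(** Only finitely many translates of [x] matter, and a basic neighbourhood of [x] excludes all those
    different from [x]. *)
Lemma isolated_cover r x : exists i, isolated r i x.
Proof.
pose A q := if `[< act q x = x >] then setT else [set z | z <> act q x].
have /W_base[i Wi sub] :
    nbhs x [set y | forall q, q \in near_words r -> A q y].
  apply: nbhs_all_seq => q _; rewrite /A; case: asboolP => [_|qx].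
    exact: filterT.
  by apply: X_accessible => xq; apply: qx.
exists i; split=> // q qr; have [qx|qx] := pselect (act q x = x); first by left.
by right=> /sub/(_ q qr); rewrite /A; case: asboolP => // _; apply.
Qed.

Lemma isolated_sparse r (A : set vtx) :
  (forall u w, A u -> A w ->
     u.2 = w.2 /\ exists i, isolated r i u.1 /\ isolated r i w.1) ->
  sparse nb r A.
Proof.
move=> HA u w Au Aw /near_wordsP[q qr wq].
have [uw2 [j [[_ uj] [Ww _]]]] := HA u w Au Aw.
case: u w wq uw2 uj Ww {Au Aw} => x b [y c] /= -> -> uj Ww.
by case: (uj q qr) => [->|].
Qed.

(* [l] lists, as words applied to [x], a finite set of vertices with fewer
   neighbours (listed in [r]) than elements after the removal of [(x, b)] and
   [act (t k) x]. *)
Definition violation (D : set vtx) (U : set X) (b : bool) (k : T)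
    (l : seq (nat * bool)) (r : seq nat) : set X := [set x |
  ((size r < size l /\ uniq l) /\
   forall p p', p \in l -> p' \in l -> p <> p' ->
     act (e p.1) x = act (e p'.1) x -> p.2 <> p'.2) /\
  forall p, p \in l ->
    (~ D (act (e p.1) x, p.2) /\ (act (e p.1) x = act 1%g x -> p.2 <> b)) /\
    forall k', U (act (t k' * e p.1)%g x) \/
      act (t k' * e p.1)%g x = act (t k) x \/
      exists j, j \in r /\ act (t k' * e p.1)%g x = act (e j) x].

(** Hall's condition after matching [u] through [k], tested only on finite subsets of the orbit of
    [u]. These are coded by countably many lists of words, which makes the condition Borel. *)
Definition good D U (u : vtx) k :=
  ~ U (act (t k) u.1) /\ ~ exists l r, violation D U u.2 k l r u.1.

(** Taking the first good index makes the choice of partner Borel. *)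
Definition selected D U (u : vtx) k := good D U u k /\
  forall k', enum_rank k' < enum_rank k -> ~ good D U u k'.

Lemma hall_good D U u k : ~ U (act (t k) u.1) ->
  hall nb (D `|` [set u]) (U `|` [set act (t k) u.1]) -> good D U u k.
Proof.
case: u => x b /= nU H; split=> //= -[l [r [[[rl ul] inj] viol]]].
pose h (p : nat * bool) : vtx := (act (e p.1) x, p.2).
pose F : {fset vtx} := [fset w in [seq h p | p <- l]]%fset.
have FP w : w \in F -> exists2 p, p \in l & w = h p.
  by rewrite inE /= => /mapP.
have cF : #|` F| = size l.
  rewrite card_fseq undup_id ?size_map // map_inj_in_uniq // => p p' pl p'l [E1 E2].
  by apply: contrapT => /(inj _ _ pl p'l)/(_ E1).
have : #|` F| <= size r.
  apply: leq_trans (H F _) _.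
    move=> w /FP[p pl ->]; have [[nD nx] _] := viol _ pl.
    by case=> [//|[E1 E2]]; apply: nx E2; rewrite act1.
  apply: leq_trans (_ : size [seq act (e j) x | j <- r] <= _); last by rewrite size_map.
  apply: leq_trans (size_undup _); rewrite -card_fseq.
  apply: fsubset_leq_card; apply/fsubsetP => v /freeP[/nbsP[w /FP[p pl ->]]].
  move=> /trans_nbP[k' ->] /=; rewrite -actM => nUk.
  have [_ /(_ k')[Uk|[Ek|[j [jr ->]]]]] := viol _ pl.
  - by case: nUk; left.
  - by case: nUk; right.
  - by rewrite inE; apply/mapP; exists j.
by rewrite cF leqNgt rl.
Qed.

(** Split [F] into the part in the orbit of [x] and the rest; their neighbourhoods are disjoint. A
    failure of the first part would be coded as a violation, and the second part does not see the
    removed vertex, so [H] applies to it. *)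
Lemma good_hall D U u k : hall nb D U -> good D U u k ->
  hall nb (D `|` [set u]) (U `|` [set act (t k) u.1]).
Proof.
case: u => x b H [/= nU nviol] F avF.
pose orb (w : vtx) := exists i, act (e i) x = w.1.
have orb_t w k' : orb w -> exists i, act (e i) x = act (t k') w.1.
  move=> [i <-]; have [j ej] := e_t k'; have [m em] := e_mul j i.
  by exists m; rewrite em actM ej.
have orb_tV w k' i : act (e i) x = act (t k') w.1 -> orb w.
  have [j ej] := e_t k'; have [j' ej'] := e_inv j; have [m em] := e_mul j' i.
  by move=> E; exists m; rewrite em actM E ej' ej actK.
pose F1 := [fset w in F | `[<orb w>]]%fset; pose F2 := (F `\` F1)%fset.
set U' := U `|` _.
have F1P w : w \in F1 -> w \in F /\ orb w by rewrite inE => /andP[? /asboolP].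
have F2P w : w \in F2 -> w \in F /\ ~ orb w.
  rewrite !inE => /andP[+ wF]; rewrite wF => /asboolPn; split=> //.
have F1F : (F1 `<=` F)%fset by apply/fsubsetP => w /F1P[].
have le1 : #|` F1| <= #|` free nb U' F1|.
  rewrite leqNgt; apply/negP => lt; apply: nviol.
  have /choice[a aP] : forall w, exists i, w \in F1 -> act (e i) x = w.1.
    move=> w; have [/F1P[_ [i <-]]|_] := boolP (w \in F1); last by exists 0.
    by exists i.
  have /choice[c cP] : forall v, exists i, v \in nbs nb F1 -> act (e i) x = v.
    move=> v; have [/nbsP[w /F1P[_ /orb_t o] /trans_nbP[k' ->]]|_] := boolP (v \in _).
      by have [i Ei] := o k'; exists i.
    by exists 0.
  exists [seq (a w, w.2) | w <- enum_fset F1].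
  exists [seq c v | v <- enum_fset (free nb U' F1)]; split; [split; [split|]|].
  - by rewrite !size_map.
  - rewrite map_inj_in_uniq ?fset_uniq // => w w' wF wF' [E1 E2].
    apply/eqP; rewrite [w]surjective_pairing [w']surjective_pairing.
    by rewrite -(aP w wF) -(aP w' wF') E1 E2.
  - move=> _ _ /mapP[w wF ->] /mapP[w' wF' ->] /= ne.
    rewrite (aP w wF) (aP w' wF') => E1 E2; apply: ne.
    suff -> : w = w' by [].
    by rewrite [w]surjective_pairing [w']surjective_pairing E1 E2.
  - move=> _ /mapP[w wF ->] /=; rewrite (aP w wF) act1 -surjective_pairing.
    have [wFF ow] := F1P w wF; have nDw := avF w wFF.
    split.
      split=> [Dw|E1 E2]; apply: nDw; [by left|right].
      by rewrite /= [w]surjective_pairing E1 E2.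
    move=> k'; rewrite actM (aP w wF).
    have [Uw|nUw] := pselect (U (act (t k') w.1)); first by left.
    right; have [Ek|nEk] := pselect (act (t k') w.1 = act (t k) x); first by left.
    right; exists (c (act (t k') w.1)).
    have vF1 : act (t k') w.1 \in nbs nb F1.
      by apply/nbsP; exists w => //; apply/trans_nbP; exists k'.
    split; last by rewrite cP.
    by apply: map_f; apply/freeP; split=> // -[].
have sep v : v \in nbs nb F2 -> ~ exists i, act (e i) x = v.
  move=> /nbsP[w /F2P[_ now] /trans_nbP[k' ->]] [i Ei]; apply: now.
  exact: orb_tV Ei.
have le2 : #|` F2| <= #|` free nb U' F2|.
  have av2 : avoids D F2 by move=> w /F2P[/avF nDw _] Dw; apply: nDw; left.
  apply: leq_trans (H _ av2) _; apply: fsubset_leq_card.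
  apply/fsubsetP => v /freeP[vF nUv]; apply/freeP; split=> // -[//|/= vE].
  by apply: sep vF _; have [i ei] := e_t k; exists i; rewrite ei vE.
have FE : F = (F1 `|` F2)%fset.
  by rewrite fsetUDl fsetDv fsetD0 (elimT (fsetUidPr _ _) F1F).
have := cardfsUI (free nb U' F1) (free nb U' F2); rewrite -freeU -FE.
have -> : (free nb U' F1 `&` free nb U' F2 = fset0)%fset.
  apply/fsetP => v; rewrite in_fsetI in_fset0; apply/negbTE/negP => /andP[].
  move=> /freeP[/nbsP[w /F1P[_ ow] /trans_nbP[k' ->]] _] /freeP[/sep nv _].
  by apply: nv; exact: orb_t.
have := cardfsDS F1F; have := fsubset_leq_card F1F; rewrite -/F2 cardfs0; lia.
Qed.

Lemma selected_ex D U u : hall nb D U -> ~ D u -> exists k, selected D U u k.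
Proof.
move=> H nD; have [v /trans_nbP[k ->] [nU H']] := hall_choice H nD.
pose P k' := `[< good D U u k' >].
have Pk : P k by apply/asboolP; exact: hall_good.
case: (arg_minnP (fun k' => nat_of_ord (enum_rank k')) Pk) => k' /asboolP gk' min.
by exists k'; split=> // k'' lt /asboolP/min; rewrite leqNgt lt.
Qed.

Lemma selected_inj D U u k k' : selected D U u k -> selected D U u k' -> k = k'.
Proof.
move=> [gk mk] [gk' mk']; apply: enum_rank_inj; apply/val_inj => /=.
by case: (ltngtP (enum_rank k) (enum_rank k')) => // [/mk'|/mk].
Qed.

Definition borel_vtx (A : set vtx) := forall b, borel [set x | A (x, b)].

Lemma borel_violation D U b k l r : borel_vtx D -> borel U ->
  borel (violation D U b k l r).
Proof.
move=> bD bU; apply: borel_and.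
  apply: borel_and; first exact: borel_cst.
  do 2!apply: borel_all => ?; do 3!(apply: borel_imp; first exact: borel_cst).
  by apply: borel_imp; [exact: borel_eq|exact: borel_cst].
apply: borel_all => p; apply: borel_imp; first exact: borel_cst.
apply: borel_and.
  apply: borel_and.
    by apply: borel_not; apply: (@borel_act _ [set y | D (y, p.2)]).
  by apply: borel_imp; [exact: borel_eq|exact: borel_cst].
apply: borel_all => k'; apply: borel_or; first exact: borel_act.
apply: borel_or; first exact: borel_eq.
by apply: borel_ex => j; apply: borel_and; [exact: borel_cst|exact: borel_eq].
Qed.

Lemma borel_good D U k b : borel_vtx D -> borel U ->
  borel [set x | good D U (x, b) k].
Proof.
move=> bD bU; apply: borel_and; apply: borel_not; first exact: borel_act.
by do 2!apply: borel_ex => ?; exact: borel_violation.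
Qed.

Lemma borel_selected D U k b : borel_vtx D -> borel U ->
  borel [set x | selected D U (x, b) k].
Proof.
move=> bD bU; apply: borel_and; first exact: borel_good.
apply: borel_all => k'; apply: borel_imp; first exact: borel_cst.
by apply: borel_not; exact: borel_good.
Qed.

Variable A : nat -> set vtx.
Hypothesis A_borel : forall n, borel_vtx (A n).
Hypothesis A_sparse : forall n, sparse nb (2 ^ n.+2) (A n).
Hypothesis expansion : forall F : {fset vtx}, 2 * #|` F| <= #|` nbs nb F|.

Definition picked (s : set vtx * set X) B k : set vtx :=
  [set u | (B u /\ ~ s.1 u) /\ selected s.1 s.2 u k].

(** The vertices handled before stage [n], and their partners. New partners are written as a
    preimage under [act (t k)^-1], not as an image, which keeps them Borel. *)
Fixpoint state n : set vtx * set X :=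
  if n is n'.+1 then
    ((state n').1 `|` A n', (state n').2 `|`
      [set v | exists k b, picked (state n') (A n') k (act (t k)^-1%g v, b)])
  else (set0, set0).

Definition matched b k : set X :=
  [set x | exists n, picked (state n) (A n) k (x, b)].

Lemma borel_picked s B k b : borel_vtx s.1 -> borel s.2 -> borel_vtx B ->
  borel [set x | picked s B k (x, b)].
Proof.
move=> bs1 bs2 bB; apply: borel_and; last exact: borel_selected.
apply: borel_and; first exact: bB.
by apply: borel_not; exact: bs1.
Qed.

Lemma borel_state n : borel_vtx (state n).1 /\ borel (state n).2.
Proof.
elim: n => [|n [IH1 IH2]] /=.
  by split=> [b|]; change (borel (@set0 X)); apply: borel_open; exact: open0.
split=> [b|]; first exact: borel_or (IH1 b) (A_borel n b).
apply: borel_or => //; apply: borel_ex => k; apply: borel_ex => b.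
apply: (@borel_act _ [set x | picked (state n) (A n) k (x, b)]).
by apply: borel_picked => //; exact: A_borel.
Qed.

Lemma borel_matched b k : borel (matched b k).
Proof.
by apply: borel_ex => n; have [? ?] := borel_state n; exact: borel_picked.
Qed.

Lemma state_mono n m : n <= m -> (state n).1 `<=` (state m).1 /\
  (state n).2 `<=` (state m).2.
Proof.
elim: m => [|m IH]; first by rewrite leqn0 => /eqP ->; split.
rewrite leq_eqVlt => /orP[/eqP ->|]; first by split.
rewrite ltnS => /IH[IH1 IH2].
by split=> z nz; left; [exact: IH1|exact: IH2].
Qed.

Lemma state_picked n u : (state n).1 u ->
  exists2 m, m < n & A m u /\ ~ (state m).1 u.
Proof.
elim: n => [//|n IH] /= Dn.
have [/IH[m mn Am]|nD] := pselect ((state n).1 u).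
  by exists m; rewrite // ltnS ltnW.
by exists n => //; split=> //; case: Dn.
Qed.

Lemma state_choice n : hall nb (state n).1 (state n).2 ->
  exists c : vtx -> X, forall u, (A n `\` (state n).1) u ->
    exists2 k, picked (state n) (A n) k u & c u = act (t k) u.1.
Proof.
move=> H; suff /choice[c cP] : forall u, exists v, (A n `\` (state n).1) u ->
    exists2 k, picked (state n) (A n) k u & v = act (t k) u.1 by exists c.
move=> u; have [[Au nD]|nA] := pselect ((A n `\` (state n).1) u).
  by have [k sk] := selected_ex H nD; exists (act (t k) u.1) => _; exists k.
by exists u.1.
Qed.

(** At stage 0 both invariants are the doubling hypothesis. Later stages apply the one-stage lemmas
    to the points of [A n] not handled before. *)
Lemma state_inv n : hall nb (state n).1 (state n).2 /\
  expands nb n (state n).1 (state n).2.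
Proof.
elim: n => [|n [IH1 IH2]].
  have free0 F : free nb set0 F = nbs nb F.
    apply/fsetP => v; apply/idP/idP => [/freeP[]//|vF].
    by apply/freeP; split.
  split=> F; rewrite free0; first by have := expansion F; lia.
  by move=> _ _ _; rewrite expn0 mul1n; exact: expansion.
have [c cP] := state_choice IH1.
set D := (state n).1 in IH1 IH2 cP *; set U := (state n).2 in IH1 IH2 cP *.
have E1 : (state n.+1).1 = D `|` (A n `\` D).
  rewrite /= -/D; apply/seteqP; split=> u; last by case=> [|[]]; [left|right].
  by case=> [|Au]; [left|have [|] := pselect (D u); [left|right]].
have E2 : (state n.+1).2 = U `|` [set c u | u in A n `\` D].
  rewrite /= -/U; apply/seteqP; split=> v.
    case=> [|[k [b pk]]]; [by left|right].
    have [[Au nD] sk] := pk; exists (act (t k)^-1%g v, b) => //.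
    have [k' [_ sk'] ->] := cP _ (conj Au nD).
    by rewrite (selected_inj sk' sk) actVK.
  case=> [|[u Au <-]]; [by left|right].
  have [k pk ->] := cP u Au.
  by exists k, u.2; rewrite actK -surjective_pairing.
have sA : sparse nb (2 ^ n.+2) (A n `\` D).
  by move=> u w [Au _] [Aw _]; exact: A_sparse.
have cnb u : (A n `\` D) u -> c u \in nb u.
  by move=> /cP[k _ ->]; apply/trans_nbP; exists k.
rewrite E1 E2; split; last exact: expands_step.
apply: (hall_step IH1 IH2) => // u /cP[k [_ [gk _]] ->].
exact: good_hall.
Qed.

(** Within one stage a common partner puts two vertices at distance 1, against sparseness; across
    stages the earlier partner is already used, and [good] excludes it. *)
Lemma matched_inj b b' k k' x x' : matched b k x -> matched b' k' x' ->
  act (t k) x = act (t k') x' -> (x, b) = (x', b').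
Proof.
move=> [n pn] [n' pn'].
wlog : n n' b b' k k' x x' pn pn' / n <= n' => [H E|].
  have [nn'|/ltnW nn'] := leqP n n'; first exact: H pn pn' nn' E.
  by apply/esym; apply: H pn' pn nn' _.
have [[An nD] sk] := pn; have [[An' nD'] sk'] := pn'.
rewrite leq_eqVlt => /orP[/eqP nn'|lt] E.
  rewrite -nn' in An'; apply: (A_sparse An An').
  apply: (@near_leq _ _ _ 1); first by rewrite expn_gt0.
  apply: share_near; exists (act (t k) x).
    by apply/trans_nbP; exists k.
  by apply/trans_nbP; exists k'.
have [_ sub] := state_mono lt.
have [[/= nU _] _] := sk'; case: nU; apply: sub; right.
by exists k, b; rewrite -E actK.
Qed.

Lemma matched_fun b k k' x : matched b k x -> matched b k' x -> k = k'.
Proof.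
move=> [n pn] [n' pn'].
wlog : n n' k k' pn pn' / n <= n' => [H|].
  have [nn'|/ltnW nn'] := leqP n n'; first exact: H pn pn' nn'.
  by apply/esym; exact: H pn' pn nn'.
have [[An nD] sk] := pn; have [[An' nD'] sk'] := pn'.
rewrite leq_eqVlt => /orP[/eqP nn'|lt].
  by rewrite -nn' in sk'; exact: selected_inj sk sk'.
by have [sub _] := state_mono lt; case: nD'; apply: sub; right.
Qed.

Lemma matched_cover n x b : A n (x, b) -> exists k, matched b k x.
Proof.
move=> An; have [m [Am nD]] : exists m, A m (x, b) /\ ~ (state m).1 (x, b).
  have [/state_picked[m _]|] := pselect ((state n).1 (x, b)); first by exists m.
  by exists n.
have [k sk] := selected_ex (state_inv m).1 nD.
by exists k, m.
Qed.


(** * Paradoxical decompositions from matchings *)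

(** Quantifying over all of the subgroup [e] makes this set invariant under it. *)
Definition covered : set X :=
  [set x | forall i b, exists n, A n (act (e i) x, b)].

Lemma covered_act i x : covered (act (e i) x) <-> covered x.
Proof.
split=> cx j b.
  have [i' ei'] := e_inv i; have [m em] := e_mul j i'.
  by have [n An] := cx m b; exists n; rewrite em ei' actM actK in An.
have [m em] := e_mul j i.
by have [n An] := cx m b; exists n; rewrite -actM -em.
Qed.

Lemma borel_covered : borel covered.
Proof.
apply: borel_all => i; apply: borel_all => b; apply: borel_ex => n.
by apply: (@borel_act _ [set x | A n (x, b)]); exact: A_borel.
Qed.

Lemma matched_covered b x : covered x -> exists k, matched b k x.
Proof.
move=> cx; have [i ei] := e_one; have [n An] := cx i b.
by apply: (@matched_cover n); rewrite ei act1 in An.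
Qed.

(* Schroeder-Bernstein: write [f b x = act (t k) x] if [matched b k x]. The
   image [S] of [f false] is one half of the decomposition. Its complement
   contains the image of [f true], and [chain] is the union of the iterated
   images of [S] under [f true]. *)
Fixpoint chain_step n : set X :=
  if n is n'.+1 then [set y | exists k, matched true k (act (t k)^-1%g y) /\
                                        chain_step n' (act (t k)^-1%g y)]
  else [set y | exists k, matched false k (act (t k)^-1%g y)].

Definition chain : set X := [set y | exists n, chain_step n y].

(** [chain] is the disjoint union of [S] and the image of [chain] under [f true]. Hence the [true]
    pieces partition the complement of [S]; undoing [f true] on that image and fixing the points off
    [chain] recovers everything. *)
Definition sb_piece (b : bool) (o : option T) : set X :=
  match b, o with
  | false, Some k => [set y | matched false k (act (t k)^-1%g y)]
  | false, None => [set y | False]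
  | true, Some k =>
    [set y | matched true k (act (t k)^-1%g y) /\ chain (act (t k)^-1%g y)]
  | true, None => [set y | ~ chain y]
  end.

Definition sb_elt (o : option T) : G := if o is Some k then (t k)^-1%g else 1%g.

Lemma borel_chain : borel chain.
Proof.
have bm b k : borel [set y | matched b k (act (t k)^-1%g y)].
  by apply: (@borel_act _ (matched b k)); exact: borel_matched.
apply: borel_ex; elim=> [|n IH] /=; apply: borel_ex => k; first exact: bm.
by apply: borel_and; [exact: bm|exact: borel_act].
Qed.

Lemma borel_sb_piece b o : borel (sb_piece b o).
Proof.
have bm c k : borel [set y | matched c k (act (t k)^-1%g y)].
  by apply: (@borel_act _ (matched c k)); exact: borel_matched.
case: b o => [] [k|] /=; last exact: borel_cst.
- by apply: borel_and; [exact: bm|apply: borel_act; exact: borel_chain].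
- by apply: borel_not; exact: borel_chain.
- exact: bm.
Qed.

Lemma matched_inj_image b b' k k' y :
  matched b k (act (t k)^-1%g y) -> matched b' k' (act (t k')^-1%g y) ->
  b = b' /\ k = k'.
Proof.
move=> m m'; have := matched_inj m m'; rewrite !actVK => /(_ erefl)[E bb'].
by split=> //; rewrite -E -bb' in m'; exact: matched_fun m m'.
Qed.

(* [P b k] are the pieces of the [b]-half, and [g k] moves [P b k]. *)
Definition labelling (K : finType) (g : K -> G) (P : bool -> K -> set X)
    (Y : set X) :=
  (forall x, Y x -> exists! bk : bool * K, P bk.1 bk.2 x) /\
  (forall b y, Y y -> exists! k, P b k (act (g k)^-1%g y)).

Lemma sb_labelling : labelling sb_elt sb_piece covered.
Proof.
split=> [y _|b y cy].
  (* The cases are [S], the rest of [chain], and the complement of [chain]. *)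
  have [[k mk]|nS] := pselect (chain_step 0 y).
    exists (false, Some k); split=> // -[[] [k'|]] //=.
    - by move=> [mk' _]; have [] := matched_inj_image mk mk'.
    - by case; exists 0, k.
    - by move=> mk'; have [_ ->] := matched_inj_image mk mk'.
  have [[[//|n] [k [mk cn]]]|nC] := pselect (chain y).
    exists (true, Some k); split=> [|[[] [k'|]]] //=; first by split=> //; exists n.
    - by move=> [mk' _]; have [_ ->] := matched_inj_image mk mk'.
    - by case; exists n.+1, k.
    - by move=> mk'; case: nS; exists k'.
  exists (true, None); split=> [//|[[] [k'|]]] //=.
  - by move=> [mk' [n cn]]; case: nC; exists n.+1, k'.
  - by move=> mk'; case: nS; exists k'.
have [k mk] := matched_covered b cy; case: b mk => mk.
  have [Cy|nCy] := pselect (chain y).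
    exists (Some k); split=> [|[k'|]] /=; rewrite ?invgK ?actK //.
      by move=> [mk' _]; rewrite (matched_fun mk mk').
    by rewrite invg1 act1 => /(_ Cy).
  exists None; split=> [|[k'|]] /=; rewrite ?invg1 ?act1 ?invgK ?actK //.
  by case.
exists (Some k); split=> [|[k'|]] /=; rewrite ?invgK ?actK //.
by move=> mk'; rewrite (matched_fun mk mk').
Qed.

End GroupAction.

(** * Labellings: conversion, gluing and expansion *)

Section Labelling.
Variables (G : groupType) (X : topologicalType) (act : G -> X -> X).
Hypothesis act_action : group_action act.

Let actM := actM act_action.
Let actK := actK act_action.
Let actVK := actVK act_action.

Lemma decomposition_labelling (n m : nat) (A : 'I_n -> set X)
    (B : 'I_m -> set X) (alpha : 'I_n -> G) (beta : 'I_m -> G) :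
  paradoxical_decomposition act A B alpha beta ->
  exists (g : 'I_n + 'I_m -> G) (P : bool -> 'I_n + 'I_m -> set X),
    labelling act g P [set: X].
Proof.
move=> [[cov triv _] trA trB covA covB].
exists (fun k => match k with inl i => alpha i | inr j => beta j end).
(* Both halves share one index type, so an index of the other half receives the empty piece. *)
exists (fun b k => match b, k with
  | true, inl i => A i | false, inr j => B j | _, _ => set0 end).
split=> [x _|b y _].
  have : (\bigcup_(k in [set: 'I_n + 'I_m]) pieces A B k) x by rewrite [X in X x]cov.
  case=> k _ kx; exists (if k is inl _ then true else false, k); split.
    by case: k kx.
  move=> [b k'] /= k'x.
  have kk' : k = k'.
    by apply: triv => //; exists x; split=> //; case: b k' k'x => [] [].
  by subst k'; case: b k k'x {kx} => [] [].
case: b.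
  have : (\bigcup_i (act (alpha i) @` A i)) y by rewrite covA.
  move=> [i _ [x Ax xy]]; exists (inl i); split; first by rewrite -xy actK.
  move=> [i'|//] Ax'; congr inl; apply: trA => //; exists y; split; first by exists x.
  by exists (act (alpha i')^-1%g y) => //; rewrite actVK.
have : (\bigcup_j (act (beta j) @` B j)) y by rewrite covB.
move=> [j _ [x Bx xy]]; exists (inr j); split; first by rewrite -xy actK.
move=> [//|j'] Bx'; congr inr; apply: trB => //; exists y; split; first by exists x.
by exists (act (beta j')^-1%g y) => //; rewrite actVK.
Qed.

(** A partition has nonempty pieces, so only the labels in [N b], those with a nonempty piece, are
    kept and renumbered. *)
Lemma labelling_decomposition (K : finType) (g : K -> G)
    (P : bool -> K -> set X) :
  labelling act g P [set: X] ->
  exists (n m : nat) (A : 'I_n -> set X) (B : 'I_m -> set X)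
         (alpha : 'I_n -> G) (beta : 'I_m -> G),
    [/\ paradoxical_decomposition act A B alpha beta,
        forall i, exists k, A i = P true k & forall j, exists k, B j = P false k].
Proof.
move=> [P1 P2].
pose N b := [pred k | `[< P b k !=set0 >]].
pose piece b (i : 'I_#|N b|) := P b (enum_val i).
pose elt b (i : 'I_#|N b|) := g (enum_val i).
have rank b k x : P b k x -> exists i : 'I_#|N b|, enum_val i = k.
  move=> Pk; have kN : k \in N b by rewrite inE; apply/asboolP; exists x.
  by exists (enum_rank_in kN k); rewrite enum_rankK_in.
have triv b : trivIset [set: 'I_#|N b|] (fun i => act (elt b i) @` piece b i).
  move=> i j _ _ [y [[x Px xy] [x' Px' x'y]]].
  have [k [_ ku]] := P2 b y I.
  apply: enum_val_inj; transitivity k; first by apply/esym/ku; rewrite -xy actK.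
  by apply: ku; rewrite -x'y actK.
have covP b : \bigcup_i (act (elt b i) @` piece b i) = [set: X].
  apply/seteqP; split=> // y _; have [k [Pk _]] := P2 b y I.
  have [i ik] := rank _ _ _ Pk; exists i => //.
  by exists (act (g k)^-1%g y); rewrite /piece /elt ik ?actVK.
exists #|N true|, #|N false|, (piece true), (piece false), (elt true), (elt false).
split; [|by move=> i; exists (enum_val i)|by move=> i; exists (enum_val i)].
split=> //; split.
- apply/seteqP; split=> // x _; have [[b k] [/= Pk _]] := P1 x I.
  have [i ik] := rank _ _ _ Pk; case: b i Pk ik => i Pk ik.
    by exists (inl i); rewrite //= /piece ik.
  by exists (inr i); rewrite //= /piece ik.
- move=> i j _ _ [x [xi xj]]; have [bk [_ bku]] := P1 x I.
  case: i j xi xj => i [j|j] xi xj.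
  + have := bku (true, enum_val i) xi; rewrite (bku (true, enum_val j) xj).
    by case=> /enum_val_inj ->.
  + by have := bku (true, enum_val i) xi; rewrite (bku (false, enum_val j) xj).
  + by have := bku (false, enum_val i) xi; rewrite (bku (true, enum_val j) xj).
  + have := bku (false, enum_val i) xi; rewrite (bku (false, enum_val j) xj).
    by case=> /enum_val_inj ->.
- by move=> [i|i] _; have := enum_valP i; rewrite inE => /asboolP.
Qed.

(** By invariance no group element moves a point across the border of [Y], so the two labellings do
    not interfere. *)
Lemma labelling_glue (K K' : finType) (g : K -> G) (g' : K' -> G) P P'
    (Y : set X) :
  (forall k x, Y (act (g k)^-1%g x) <-> Y x) ->
  (forall k x, Y (act (g' k)^-1%g x) <-> Y x) ->
  labelling act g P [set: X] -> labelling act g' P' Y ->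
  labelling act (fun k => match k with inl k => g k | inr k => g' k end)
    (fun b k => match k with
                | inl k => [set x | ~ Y x /\ P b k x]
                | inr k => [set x | Y x /\ P' b k x] end) [set: X].
Proof.
move=> Yg Yg' [P1 P2] [P1' P2']; split=> [x _|b y _].
  have [Yx|nYx] := pselect (Y x).
    have [[b k] [/= Pk ku]] := P1' x Yx.
    exists (b, inr k); split=> // -[b' [k'|k']] /= [] // _ Pk'.
    by have [-> ->] := ku (b', k') Pk'.
  have [[b k] [/= Pk ku]] := P1 x I.
  exists (b, inl k); split=> // -[b' [k'|k']] /= [] // _ Pk'.
  by have [-> ->] := ku (b', k') Pk'.
have [Yy|nYy] := pselect (Y y).
  have [k [Pk ku]] := P2' b y Yy.
  exists (inr k); split=> [|[k'|k']] /=; first by split=> //; exact/Yg'.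
    by move=> [nY]; case: nY; exact/Yg.
  by move=> [_ /ku ->].
have [k [Pk ku]] := P2 b y I.
exists (inl k); split=> [|[k'|k']] /=; first by split=> // /Yg.
  by move=> [_ /ku ->].
by move=> [/Yg'].
Qed.

(** Undoing the moves gives an injection [f] of two copies of [X] into [X]. Composing it with
    itself, [h] injects two copies of [X * bool] into [X], with values among the neighbours; this is
    why the translates are products of two inverses. *)
Lemma labelling_expansion (K : finType) (g : K -> G) P :
  labelling act g P [set: X] -> forall F : {fset X * bool},
  2 * #|` F| <= #|` nbs (trans_nb act (fun kl : K * K =>
                           ((g kl.2)^-1 * (g kl.1)^-1)%g)) F|.
Proof.
move=> [P1 P2].
have /choice[c cP] : forall yb : X * bool, exists k, P yb.2 k (act (g k)^-1%g yb.1).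
  by move=> [y b]; have [k [Pk _]] := P2 b y I; exists k.
pose f yb := act (g (c yb))^-1%g yb.1.
have f_inj : injective f.
  move=> [y b] [y' b'] E; have := cP (y, b); have := cP (y', b') => /=.
  rewrite -/(f (y, b)) -/(f (y', b')) E => p' p.
  have [bk [_ u]] := P1 (f (y', b')) I.
  have := u (b, c (y, b)) p; rewrite (u (b', c (y', b')) p') => -[bb cc].
  by move: E; rewrite bb in cc *; rewrite /f /= cc => /(can_inj (actK _)) ->.
pose h (b : bool) (u : X * bool) := f (f (u.1, b), u.2).
have h_inj b b' u u' : h b u = h b' u' -> b = b' /\ u = u'.
  by case: u u' => [x d] [x' d'] /f_inj[/f_inj[-> ->] ->].
move=> F; set N := nbs _ F.
pose H b := [fset h b u | u in F]%fset.
have HN b : (H b `<=` N)%fset.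
  apply/fsubsetP => _ /imfsetP[u uF ->]; apply/nbsP; exists u => //.
  apply/trans_nbP; exists (c (u.1, b), c (f (u.1, b), u.2)).
  by rewrite /h {1}/f /= actM.
have cH b : #|` H b| = #|` F|.
  by rewrite card_in_imfset //= => u u' _ _ /h_inj[].
have := cardfsUI (H true) (H false); rewrite !cH.
have -> : (H true `&` H false = fset0)%fset.
  apply/fsetP => v; rewrite in_fsetI in_fset0; apply/negbTE/negP => /andP[].
  by move=> /imfsetP[u _ ->] /imfsetP[u' _ /h_inj[]].
have /fsubset_leq_card : (H true `|` H false `<=` N)%fset by rewrite fsubUset !HN.
rewrite cardfs0; lia.
Qed.

End Labelling.

Theorem theorem1p1 (R : realType) (G : groupType) (X : topologicalType)
    (act : G -> X -> X)
    (X_polish : polish R X)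
    (act_action : group_action act)
    (act_borel : forall g : G, borel_map (act g))
    (act_paradoxical :
       exists (n m : nat) (A : 'I_n -> set X) (B : 'I_m -> set X)
              (alpha : 'I_n -> G) (beta : 'I_m -> G),
         paradoxical_decomposition act A B alpha beta) :
  exists (n m : nat) (A : 'I_n -> set X) (B : 'I_m -> set X)
         (alpha : 'I_n -> G) (beta : 'I_m -> G),
    paradoxical_decomposition act A B alpha beta /\
    (forall i : 'I_n, baire_property (A i)) /\
    (forall j : 'I_m, baire_property (B j)).
Proof.
have [W W_open W_base] := polish_countable_base X_polish.
have acc (x y : X) : x <> y -> nbhs x [set z | z <> y].
  exact: polish_accessible X_polish.
have [n [m [A0 [B0 [alpha [beta /(decomposition_labelling act_action)]]]]]] :=
  act_paradoxical.
move=> [g [P gP]]; set K := ('I_n + 'I_m)%type in g P gP.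
have [e [e1 eM eV eg]] := countable_closure g.
pose t (kl : K * K) := ((g kl.2)^-1 * (g kl.1)^-1)%g.
have et k : exists i, e i = t k.
  have [i ei] := eg k.1; have [j ej] := eg k.2.
  have [i' ei'] := eV i; have [j' ej'] := eV j; have [l el] := eM j' i'.
  by exists l; rewrite el ei' ej' ei ej.
(* The isolation radius at stage [r] is the sparseness that stage [r] of the matching requires. *)
have bI r i : borel (isolated act W t (2 ^ r.+2) i) by exact: borel_isolated.
have cI r x : exists i, isolated act W t (2 ^ r.+2) i x by exact: isolated_cover.
have [A [bA spA mA]] := generic_cover act_borel W_base e bI cI.
have sA r : sparse (trans_nb act t) (2 ^ r.+2) (A r).
  exact: isolated_sparse (spA r).
have expA := labelling_expansion act_action gP.
pose Y := covered act e A; pose Q := sb_piece act t e A.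
have Yt i x : Y (act (e i) x) <-> Y x by exact: covered_act.
have YV h x : (exists i, e i = h) -> Y (act h^-1%g x) <-> Y x.
  by move=> [i ei]; have [j ej] := eV i; rewrite -ei -ej.
have gQ : labelling act (sb_elt t) Q Y by exact: sb_labelling.
have YsbV o x : Y (act (sb_elt t o)^-1%g x) <-> Y x.
  apply: YV; case: o => [k|]; last exact: e1.
  by have [i ei] := et k; have [j ej] := eV i; exists j; rewrite ej ei.
have glued := labelling_glue (fun k x => YV _ x (eg k)) YsbV gP gQ.
have [n' [m' [A' [B' [a [b [dec AP BP]]]]]]] :=
  labelling_decomposition act_action glued.
suff bP c k : baire_property (match k with
    | inl k => [set x | ~ Y x /\ P c k x]
    | inr k => [set x | Y x /\ Q c k x] end).
  exists n', m', A', B', a, b; split=> //.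
  by split=> i; [have [k ->] := AP i|have [k ->] := BP i].
(* Old pieces lie in the meager complement of [Y]; new pieces are Borel. *)
case: k => k; first by apply: meager_baire_property; apply: meagerS mA => x [].
apply: borel_baire_property; apply: borel_and; first exact: borel_covered.
exact: borel_sb_piece.
Qed.
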